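(* Let $\alpha\ge3$, $\beta\ge0$, $t_0>0$, let $u_0,v_0\in\mathcal{H}$, and let $x:[t_0,+\infty)\to\mathcal{H}$ be the unique global $C^2$-solution of $$\ddot{x}(t)+\frac{\alpha}{t}\dot{x}(t)+\beta\nabla^2 g(x(t))\dot{x}(t)+\nabla g(x(t))+\epsilon(t)x(t)=0\quad (t\ge t_0),\qquad x(t_0)=u_0,\ \dot{x}(t_0)=v_0.$$ Assume that $$\int_{t_0}^{+\infty}\frac{\epsilon(t)}{t}\,dt<+\infty\quad\text{and}\quad \lim_{t\to+\infty}\frac{\beta}{\epsilon(t)\,t^{\frac{\alpha}{3}+1}}\int_{t_0}^{t}\epsilon^2(s)\,s^{\frac{\alpha}{3}+1}\,ds=0,$$ and that there exist $a>1$ and $t_1\ge t_0$ such that $$\dot{\epsilon}(t)\le-\frac{a\beta}{2}\epsilon^2(t)\quad\text{for every } t\ge t_1.$$ In addition, assume that: - in case $\alpha=3$: $\lim_{t\to+\infty}t^2\epsilon(t)=+\infty$; - in case $\alpha>3$: there exists $c>0$ such that $t^2\epsilon(t)\ge\frac{2}{3}\alpha\left(\frac{1}{3}\alpha-1+\beta c^2\right)$ for all $t$ large enough. Let $x^*=\operatorname{argmin}\{\|x\|:x\in\operatorname{argmin} g\}$ be the element of minimum norm of the nonempty convex closed set $\operatorname{argmin} g$. Then $$\liminf_{t\to+\infty}\|x(t)-x^*\|=0.$$ In addition, $$\lim_{t\to+\infty}\|x(t)-x^*\|=0$$ if there exists $T\ge t_0$ such that the trajectory $\{x(t):t\ge T\}$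 stays either in the ball $B(0,\|x^*\|)$ or in its complement.
   Context: $\mathcal{H}$ is a real Hilbert space. Standing assumptions: $g:\mathcal{H}\to\mathbb{R}$ is convex and twice Fréchet differentiable, its gradient $\nabla g$ is Lipschitz continuous on bounded sets, and $\operatorname{argmin} g\ne\emptyset$; $\epsilon:[t_0,+\infty)\to[0,+\infty)$ is nonincreasing, of class $C^1$, with $\lim_{t\to+\infty}\epsilon(t)=0$. $B(0,r)=\{z\in\mathcal{H}:\|z\|<r\}$ denotes the open ball of radius $r$ centred at $0$; thus staying in the ball means $\|x(t)\|<\|x^*\|$ for all $t\ge T$, and staying in its complement means $\|x(t)\|\ge\|x^*\|$ for all $t\ge T$. *)

(* Defs.v *)
From mathcomp Require Import all_boot all_order all_algebra.
From mathcomp Require Export sesquilinear.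
From mathcomp Require Import all_classical all_reals all_analysis.

Set Implicit Arguments.
Unset Strict Implicit.
Unset Printing Implicit Defensive.
Import Order.TTheory GRing.Theory Num.Theory.
Import numFieldNormedType.Exports.

Local Open Scope classical_set_scope.
Local Open Scope ring_scope.

Definition argmin_on (R : realType) (T : Type) (A : set T) (f : T -> R) : set T :=
  [set z | A z /\ forall y, A y -> f z <= f y].

(* Derivative relative to a set: on `[t0, +oo[ it is the usual derivative at
   every t > t0 and the right derivative at t0, so that values outside the set
   are irrelevant. *)
Definition derivable_within (R : realType) (V : normedModType R)
    (A : set R) (f : R -> V) (t : R) : Prop :=
  cvg ((s - t)^-1 *: (f s - f t) @[s --> within A t^']).

Definition derive_within (R : realType) (V : normedModType R)
    (A : set R) (f : R -> V) (t : R) : V :=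
  lim ((s - t)^-1 *: (f s - f t) @[s --> within A t^']).

Definition C1_on (R : realType) (V : normedModType R)
    (A : set R) (f : R -> V) : Prop :=
  (forall t, A t -> derivable_within A f t) /\
  {within A, continuous (derive_within A f)}.

Definition C2_on (R : realType) (V : normedModType R)
    (A : set R) (f : R -> V) : Prop :=
  C1_on A f /\ C1_on A (derive_within A f).

(* A Hilbert space is a complete normed module whose norm comes from the
   positive definite symmetric form dot. *)
Definition norm_from_dot (R : realType) (H : normedModType R)
    (dot : {dot H for idfun}) : Prop :=
  forall u : H, `|u| = Num.sqrt (dot u u).

(* The Riesz representative of the differential of g at z. *)
Definition gradient (R : realType) (H : normedModType R)
    (dot : {dot H for idfun}) (g : H -> R) (z : H) : H :=
  get [set v | forall h, 'd g z h = dot v h].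

Definition hessian (R : realType) (H : normedModType R)
    (dot : {dot H for idfun}) (g : H -> R) (z : H) : H -> H :=
  'd (gradient dot g) z.

Definition twice_differentiable (R : realType) (H : normedModType R)
    (dot : {dot H for idfun}) (g : H -> R) : Prop :=
  forall z, differentiable g z /\ differentiable (gradient dot g) z.

(* Main.v *)
(* Write [p = alpha/3 - 1], [lam = 2 alpha/3], [z = x - xs], [G = grad g (x)] and
   [phi = g(x) - min g].  The energy
     E = t^p [(t^2 - beta t) phi + t^2 eps/2 (|x|^2 - |xs|^2)
              + 1/2 |lam z + t (x' + beta G)|^2]
   is chosen so that the products <x', z> and <x', G> cancel in its derivative.
   Convexity (<G, z> >= phi) and Young's inequality for the term eps <x, G> leave, for
   large t,
     E' <= t^p [(- p t eps + t^2 eps')/2 (|x|^2 - |xs|^2) + a beta/4 t^2 eps^2 |x|^2].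
   Since eps' <= - (a beta/2) eps^2 and eps -> 0, this first yields g(x(t)) -> min g
   with no assumption on |x|.  If moreover |x| >= |xs| eventually, it yields
   E <= C + (a beta/4) |xs|^2 \int eps^2 s^(alpha/3+1); dividing by t^(alpha/3+1) eps,
   phi + eps (|x|^2 - |xs|^2) <= o(1) eps.  In both regimes x(t) is an almost-minimizer
   whose norm is almost at most |xs| (at the times when |x(t)| <= |xs| in the first one),
   and by uniform convexity of the norm such points are close to xs. *)
Require Import Defs.
From mathcomp Require Import all_boot all_order all_algebra.
From mathcomp Require Import all_classical all_reals all_analysis.
From mathcomp Require Import ring lra.

Set Implicit Arguments.
Unset Strict Implicit.
Unset Printing Implicit Defensive.
Import Order.TTheory GRing.Theory Num.Theory.
Import numFieldNormedType.Exports.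

Local Open Scope classical_set_scope.
Local Open Scope ring_scope.

(** * Inner product algebra and the parallelogram identity *)

Section DotNorm.
Context (R : realType) (H : normedModType R) (dot : {dot H for idfun}).
Implicit Types u v w : H.

Lemma dotC u v : dot u v = dot v u.
Proof. by rewrite (hermC dot) expr0 mul1r. Qed.

Lemma dotDr u v w : dot u (v + w) = dot u v + dot u w.
Proof. exact: linearDr. Qed.

Lemma dotDl u v w : dot (v + w) u = dot v u + dot w u.
Proof. by rewrite dotC dotDr !(dotC u). Qed.

Lemma dotZr (k : R) u v : dot u (k *: v) = k * dot u v.
Proof. exact: linearZr. Qed.

Lemma dotZl (k : R) u v : dot (k *: u) v = k * dot u v.
Proof. by rewrite dotC dotZr dotC. Qed.

Lemma dotNr u v : dot u (- v) = - dot u v.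
Proof. by rewrite -scaleN1r dotZr mulN1r. Qed.

Lemma dotNl u v : dot (- u) v = - dot u v.
Proof. by rewrite dotC dotNr dotC. Qed.

Definition dotE := (dotDr, dotDl, dotNr, dotNl, dotZr, dotZl).

Lemma dot0r u : dot u 0 = 0.
Proof. by have := dotZr 0 u 0; rewrite scale0r mul0r. Qed.

Lemma dot_ge0 u : 0 <= dot u u.
Proof.
have [->|u0] := eqVneq u 0; first by rewrite dot0r.
exact/ltW/neq0_dnorm_gt0.
Qed.

Hypothesis Hdot : norm_from_dot dot.

Lemma dotvv u : dot u u = `|u| ^+ 2.
Proof. by rewrite Hdot sqr_sqrtr// dot_ge0. Qed.

(** Uniform convexity of half the squared norm: the term [|u - v| ^+ 2 / 8] is the gain that the
    minimization argument below asks of a midpoint. *)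
Lemma parallelogram_half u v :
  `|2^-1 *: (u + v)| ^+ 2 / 2 =
  (`|u| ^+ 2 / 2 + `|v| ^+ 2 / 2) / 2 - `|u - v| ^+ 2 / 8.
Proof. by rewrite -!dotvv !dotE (dotC v u); lra. Qed.

End DotNorm.

(* The midpoint inequality makes any sequence of almost-minimizers over the [K n] Cauchy:
   this replaces weak compactness. *)
Lemma nested_minimizer (R : realType) (H : completeNormedModType R)
    (K : nat -> set H) (f : H -> R) (p : H) (c : R) :
  (forall n, closed (K n)) ->
  (forall m n, (m <= n)%N -> K n `<=` K m) ->
  (forall n, K n p) ->
  (forall n u v, K n u -> K n v ->
     exists2 w, K n w & f w <= (f u + f v) / 2 - `|u - v| ^+ 2 / 8) ->
  continuous f -> (forall z, c <= f z) ->
  exists2 m, (forall n, K n m) &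
    forall e, 0 < e -> exists n, forall z, K n z -> f m <= f z + e.
Proof.
move=> Kclosed Kdecr Kp Kmid fcont fc.
pose d n := inf (f @` K n).
have Klb n : has_lbound (f @` K n) by exists c => _ [z _ <-].
have Kne n : f @` K n !=set0 by exists (f p); exists p.
have d_le n z : K n z -> d n <= f z by move=> Kz; apply: ge_inf => //; exists z.
have d_ub : has_ubound (range d) by exists (f p) => _ [n _ <-]; exact: d_le.
(* The infima [d n] increase as the sets shrink and are bounded by [f p], so [D] is their limit; the
   limit point [m] will satisfy [f m <= D]. *)
pose D := sup (range d).
have dD n : d n <= D by apply: ub_le_sup => //; exists n.
have Dd e : 0 < e -> exists n, D - e < d n.
  move=> e0; have [|_ [n _ <-] h] := @sup_adherent _ (range d) _ e0.
    by split=> //; exists (d 0%N), 0%N.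
  by exists n.
have exu n : exists u, K n u /\ f u < d n + harmonic n.
  have h0 : 0 < harmonic n :> R by rewrite /harmonic invr_gt0 ltr0n.
  have [//|_ [u Ku <-] h] := @inf_adherent _ (f @` K n) _ h0.
  by exists u.
have [u uP] := choice exu.
have d_incr k l : (k <= l)%N -> d k <= d l.
  move=> kl; apply: lb_le_inf => // _ [z Kz <-]; apply: d_le.
  exact: Kdecr Kz.
have inv_le k l : (k <= l)%N -> harmonic l <= harmonic k :> R.
  by move=> kl; rewrite /harmonic lef_pV2 ?posrE ?ltr0n// ler_nat ltnS.
(* Both points lie in [K n], so the [w] attached to them has [d n <= f w]; near-optimality of [u n]
   and [u k] then leaves little room for their distance. *)
have u_dist n k : (n <= k)%N ->
    `|u n - u k| ^+ 2 <= 8 * (D - d n + harmonic n).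
  move=> nk; have [Kn fn] := uP n; have [Kk fk] := uP k.
  have [w Kw fw] := Kmid n _ _ Kn (Kdecr _ _ nk _ Kk).
  by have := d_le _ _ Kw; have := dD k; have := dD n; have := inv_le _ _ nk; lra.
have u_cvg : cvgn u.
  apply/cauchy_cvgP/cauchy_exP => e e0.
  (* Once [D - d n] and [harmonic n] are both below this threshold, the bound in [u_dist] is below
     [e ^+ 2]. *)
  have e2 : 0 < e ^+ 2 / 16 by rewrite divr_gt0// exprn_gt0.
  have [n0 dn0] := Dd _ e2.
  near \oo => n.
  exists (u n); exists n => // k /= nk.
  rewrite -ball_normE /ball_/= -ltr_sqr ?nnegrE ?(ltW e0)//.
  have n0n : (n0 <= n)%N by near: n; exists n0.
  apply: le_lt_trans (u_dist _ _ nk) _.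
  have : harmonic n < e ^+ 2 / 16 by near: n; exact: near_infty_natSinv_lt (PosNum e2).
  by have := d_incr _ _ n0n; lra.
pose m := limn u.
have um : u @ \oo --> m by exact: u_cvg.
have Km n : K n m.
  apply: (@closed_cvg _ _ \oo _ u) um => //.
  by exists n => // k /= nk; apply: Kdecr nk _ _; case: (uP k).
exists m => // e e0.
have [n dn] := Dd _ e0; exists n => z Kz.
have fm : f m <= D.
  have fum : f (u k) @[k --> \oo] --> f m.
    by apply: continuous_cvg => //; exact: fcont.
  have hm : (D + harmonic k) @[k --> \oo] --> D + 0.
    by apply: cvgD; [exact: cvg_cst|exact: cvg_harmonic].
  rewrite addr0 in hm.
  apply: (ler_cvg_to fum hm); apply: nearW => k.
  by have [_ h] := uP k; rewrite (le_trans (ltW h))// lerD2r.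
by have := d_le _ _ Kz; lra.
Unshelve. all: by end_near. Qed.

(** * Riesz representation *)

Section Hilbert.
Context (R : realType) (H : completeNormedModType R) (dot : {dot H for idfun}).
Hypothesis Hdot : norm_from_dot dot.

(** The functional |z|^2/2 - L z, bounded below since [L] is bounded, has a minimizer [m] on the
    whole space; its first-order condition says that [m] represents [L]. *)
Lemma riesz (L : {linear H -> R}) : continuous L ->
  exists v, forall h, L h = dot v h.
Proof.
move=> Lc.
have [M M0 LM] : exists2 M, 0 < M & forall z, `|L z| <= M * `|z|.
  have /linear_boundedP/pinfty_ex_gt0[M M0 LM] :=
    (linear_bounded_continuous L).2 Lc.
  by exists M.
have LD u v : L (u + v) = L u + L v by exact: linearD.
have LZ (k : R) u : L (k *: u) = k * L u by exact: linearZ.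
pose f z := `|z| ^+ 2 / 2 - L z.
have [||||||m _ mP] := @nested_minimizer _ _ (fun=> setT) f 0 (- (M ^+ 2 / 2)) => //.
- move=> _ u v _ _; exists (2^-1 *: (u + v)) => //.
  by rewrite /f (parallelogram_half Hdot) LZ LD; lra.
- move=> z; apply: cvgB; last exact: Lc.
  by apply: cvgMr_tmp; apply: cvgM; exact: cvg_norm.
- move=> z; rewrite /f.
  have := LM z; have := ler_norm (L z); have := sqr_ge0 (`|z| - M).
  by lra.
exists m => h.
have fm z : f m <= f z.
  by apply/ler_addgt0Pr => e /mP[n]; exact.
pose A := dot m h - L h; pose B := dot h h / 2.
have B0 : 0 <= B by rewrite divr_ge0// dot_ge0.
have q s : 0 <= s * A + s ^+ 2 * B.
  have := fm (m + s *: h); rewrite /f -!(dotvv Hdot) !dotE LD LZ (dotC _ h m).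
  by rewrite /A /B; lra.
(* This choice turns the quadratic into minus a square, which forces [A = 0]; the added 1 keeps the
   denominator positive even if [B = 0]. *)
have := q (- A / (B + 1)).
have -> : - A / (B + 1) * A + (- A / (B + 1)) ^+ 2 * B = - (A / (B + 1)) ^+ 2.
  by field; lra.
rewrite oppr_ge0 => A0.
have : (A / (B + 1)) ^+ 2 == 0 by rewrite eq_le A0 sqr_ge0.
rewrite sqrf_eq0 mulf_eq0 invr_eq0 (gt_eqF (_ : 0 < B + 1)) ?orbF; last by lra.
by rewrite subr_eq0 => /eqP.
Qed.

End Hilbert.

(** * Convex functions and stability of the minimizer of least norm *)

Section Convex.
Context (R : realType) (H : completeNormedModType R) (dot : {dot H for idfun}).
Hypothesis Hdot : norm_from_dot dot.
Variable g : H -> R.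

(** Riesz makes the set behind [gradient] nonempty, so [get] returns a genuine representative and
    not its default. *)
Lemma gradientP z : differentiable g z ->
  forall h, 'd g z h = dot (gradient dot g z) h.
Proof.
move=> dg; have [v vP] := riesz Hdot (diff_continuous dg).
by have := @getPex _ [set v | forall h, 'd g z h = dot v h] (ex_intro _ v vP).
Qed.

Hypothesis g_convex : convex_function [set: convex_lmodType H] g.

Lemma convex_segment (s : R) u v : 0 <= s <= 1 ->
  g (s *: u + (1 - s) *: v) <= s * g u + (1 - s) * g v.
Proof.
move=> s01.
have s01' : Itv.spec (@Itv.num_sem R) (Itv.Real `[0%Z, 1%Z]) s.
  by rewrite /Itv.spec/= /Itv.num_sem/= num_real in_itv/= s01.
pose t : {i01 R} := Itv.mk s01'.
by have := g_convex t (in_setT (u : convex_lmodType H)) (in_setT (v : convex_lmodType H)).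
Qed.

(** By convexity the difference quotients of [g] from [z] towards [y], with step in ]0, 1[, are at
    most [g y - g z]; the right limit at 0 keeps this bound. *)
Lemma convex_gradient_le z y : differentiable g z ->
  g z + dot (gradient dot g z) (y - z) <= g y.
Proof.
move=> dg; rewrite -gradientP// -deriveE// addrC -lerBrDr.
have /cvg_dnbhs_at_right dc :
    s^-1 *: ((g \o shift z) (s *: (y - z)) - g z) @[s --> 0^'] --> 'D_(y - z) g z.
  exact: (diff_derivable dg).
apply: (cvgr_to_le dc); near=> s.
have s0 : 0 < s by near: s; exact: nbhs_right_gt.
have s1 : s < 1 by near: s; exact: nbhs_right_lt.
have /(convex_segment y z) : 0 <= s <= 1 by rewrite !ltW.
rewrite /= (_ : s *: (y - z) + z = s *: y + (1 - s) *: z); last first.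
  by rewrite scalerBr scalerBl scale1r addrAC addrA.
by rewrite ler_pdivrMl//; lra.
Unshelve. all: by end_near. Qed.

(** Half the squared norm is minimized over the shrinking sublevel sets [K n]. The resulting [m]
    minimizes [g], hence [|xs| <= |m|], and for some [n] no point of [K n] has much smaller norm
    than [m]. The midpoint of [z] and [xs] lies in [K n], so the parallelogram identity bounds
    [|z - xs|]. *)
Lemma min_norm_stable (xs : H) : continuous g ->
  argmin_on (argmin_on [set: H] g) (fun z => `|z|) xs ->
  forall d, 0 < d -> exists2 e, 0 < e & forall z, g z <= g xs + e ->
    `|z| ^+ 2 <= `|xs| ^+ 2 + e -> `|z - xs| <= d.
Proof.
move=> gc [[_ gmin] xsmin] d d0.
pose h : nat -> R := harmonic.
pose K n := [set z | g z <= g xs + h n].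
pose f (z : H) := `|z| ^+ 2 / 2.
have Kmid n u v : K n u -> K n v -> K n (2^-1 *: (u + v)).
  rewrite /K/= => gu gv.
  have h2 : 0 <= (2^-1 : R) <= 1 by rewrite invr_ge0 ler0n invf_le1 ?ltr0n ?ler1n.
  have := convex_segment u v h2.
  have -> : 1 - 2^-1 = 2^-1 :> R by lra.
  by rewrite -scalerDr; lra.
have fmid u v : f (2^-1 *: (u + v)) <= (f u + f v) / 2 - `|u - v| ^+ 2 / 8.
  by rewrite /f (parallelogram_half Hdot).
have [||||||m Km mP] := @nested_minimizer _ _ K f xs 0.
- move=> n; apply: (@closed_comp _ _ g [set y | y <= g xs + h n]).
    by move=> z _; exact: gc.
  exact: closed_le.
- move=> k l kl z; rewrite /K/= => /le_trans; apply.
  by rewrite lerD2l /h /harmonic lef_pV2 ?posrE ?ltr0n// ler_nat ltnS.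
- by move=> n; rewrite /K/= lerDl /h /harmonic invr_ge0 ler0n.
- by move=> n u v Ku Kv; exists (2^-1 *: (u + v)); [exact: Kmid|exact: fmid].
- move=> z; apply: cvgMr_tmp; apply: cvgM; exact: cvg_norm.
- by move=> z; rewrite divr_ge0// sqr_ge0.
have gm : g m <= g xs.
  have hh : g xs + h n @[n --> \oo] --> g xs + 0.
    by apply: cvgD; [exact: cvg_cst|exact: cvg_harmonic].
  rewrite addr0 in hh.
  by apply: (ler_cvg_to (cvg_cst (g m)) hh); apply: nearW => n; exact: Km.
have xsm : `|xs| <= `|m|.
  by apply: xsmin; split=> // y _; apply: le_trans gm _; exact: gmin.
have e0 : 0 < d ^+ 2 / 16 by rewrite divr_gt0// exprn_gt0.
have [n nP] := mP _ e0.
exists (Num.min (h n) (d ^+ 2 / 16)).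
  by rewrite lt_min e0 /h /harmonic invr_gt0 ltr0n.
move=> z gz nz.
have Kz : K n z by rewrite /K/= (le_trans gz)// lerD2l ge_min lexx.
have nz' : `|z| ^+ 2 <= `|xs| ^+ 2 + d ^+ 2 / 16.
  by rewrite (le_trans nz)// lerD2l ge_min lexx orbT.
have Kxs : K n xs by rewrite /K/= lerDl /h /harmonic invr_ge0 ler0n.
have xsm2 : `|xs| ^+ 2 <= `|m| ^+ 2 by rewrite ler_sqr ?nnegrE.
rewrite -ler_sqr ?nnegrE ?(ltW d0)//.
have := nP _ (Kmid _ _ _ Kz Kxs); have := fmid z xs; rewrite {2 3 4}/f.
move=> h2 h3; move: (f _) h2 h3 => F; lra.
Qed.

End Convex.

(** * Differential calculus along curves *)

Lemma is_derive1P (R : realType) (V : normedModType R) (f : R -> V) (t : R) df :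
  is_derive t (1 : R) f df <->
  h^-1 *: (f (h + t) - f t) @[h --> 0^'] --> df.
Proof.
have E : (fun h : R => h^-1 *: ((f \o shift t) (h *: 1) - f t)) =
         (fun h => h^-1 *: (f (h + t) - f t)).
  by apply/funext => h /=; rewrite /GRing.scale/= mulr1.
split => [[]|].
  by rewrite /derivable /derive E => dl <-.
move=> fl; split; rewrite /derivable /derive E.
  by apply/cvg_ex; exists df.
exact: cvg_lim.
Qed.

(** At an interior point of [A] every nearby point belongs to [A], so the relative difference
    quotient is the ordinary one. *)
Lemma is_derive_within (R : realType) (V : normedModType R) (A : set R)
    (f : R -> V) (t : R) : nbhs t A -> derivable_within A f t ->
  is_derive t (1 : R) f (derive_within A f t).
Proof.
move=> tA cF; apply/is_derive1P/cvgrPdist_lt => e e0.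
move/cvgrPdist_lt : cF => /(_ _ e0).
rewrite !near_withinE => h0.
have := @filterI _ _ (nbhs_filter t) _ _ tA h0; move=> /nbhs_ballP[d /= d0 hd].
apply/nbhs_ballP; exists d => // h hb hn0 /=.
have [|At] := hd (h + t).
  by move: hb; rewrite -!ball_normE /ball_/= sub0r opprD addrCA subrr addr0.
rewrite addrK; apply=> //.
by rewrite -subr_eq0 addrK.
Qed.

Lemma is_derive_continuous (R : realType) (V : normedModType R) (f : R -> V) (t : R) df :
  is_derive t (1 : R) f df -> {for t, continuous f}.
Proof. by move=> [/derivable1_diffP/differentiable_continuous]. Qed.

Lemma is_derive_comp_diff (R : realType) (U V : normedModType R) (f : R -> U)
    (F : U -> V) (t : R) df : differentiable F (f t) ->
  is_derive t (1 : R) f df ->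
  is_derive t (1 : R) (F \o f) ('d F (f t) df).
Proof.
move=> dF [/derivable1_diffP Df <-].
have dc := differentiable_comp Df dF.
split; first exact: diff_derivable.
have -> : 'D_1 f t = 'd f t 1 by exact: deriveE.
by rewrite deriveE// diff_comp.
Qed.

Section Bilinear.
Context (R : realType) (U V W : normedModType R) (B : U -> V -> W).
Hypothesis BDl : forall u u' v, B (u + u') v = B u v + B u' v.
Hypothesis BDr : forall u v v', B u (v + v') = B u v + B u v'.
Hypothesis BZl : forall k u v, B (k *: u) v = k *: B u v.
Hypothesis BZr : forall k u v, B u (k *: v) = k *: B u v.
Hypothesis Bc : forall (F : set_system R) (FF : ProperFilter F) f g a b,
  f @ F --> a -> g @ F --> b -> B (f t) (g t) @[t --> F] --> B a b.

(** One product rule for both scalar multiplication and the inner product: the increment splits into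
    B(increment of f, g(h + t)) + B(f(t), increment of g). *)
Lemma is_derive_bilinear (f : R -> U) (g : R -> V) (t : R) df dg :
  is_derive t (1 : R) f df -> is_derive t (1 : R) g dg ->
  is_derive t (1 : R) (fun s => B (f s) (g s)) (B df (g t) + B (f t) dg).
Proof.
move=> /is_derive1P fl Dg; have /is_derive1P gl := Dg.
apply/is_derive1P.
have gc : g (h + t) @[h --> 0^'] --> g t.
  have /continuous_withinNshiftx := is_derive_continuous Dg.
  exact.
have BNl u v : B (- u) v = - B u v by rewrite -scaleN1r BZl scaleN1r.
have BNr u v : B u (- v) = - B u v by rewrite -scaleN1r BZr scaleN1r.
rewrite (_ : (fun h : R => _) = (fun h => B (h^-1 *: (f (h + t) - f t)) (g (h + t))
    + B (f t) (h^-1 *: (g (h + t) - g t)))); last first.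
  apply/funext => h.
  by rewrite BZl BZr BDl BDr BNl BNr -scalerDr addrA subrK.
by apply: cvgD; apply: Bc => //; exact: cvg_cst.
Qed.

End Bilinear.

Lemma is_derive_scale (R : realType) (V : normedModType R) (k : R -> R)
    (f : R -> V) (t dk : R) df :
  is_derive t (1 : R) k dk -> is_derive t (1 : R) f df ->
  is_derive t (1 : R) (fun s => k s *: f s) (dk *: f t + k t *: df).
Proof.
apply: (@is_derive_bilinear R R V V (fun a v => a *: v)).
- by move=> u u' v; rewrite scalerDl.
- by move=> u v v'; rewrite scalerDr.
- by move=> c u v; rewrite scalerA.
- by move=> c u v; rewrite !scalerA mulrC.
- by move=> F FF ? ? a b; exact: cvgZ.
Qed.

Section DeriveDot.
Context (R : realType) (H : normedModType R) (dot : {dot H for idfun}).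
Hypothesis Hdot : norm_from_dot dot.

(** Polarization reduces joint continuity of [dot] to continuity of the norm. *)
Lemma cvg_dot (F : set_system R) (FF : ProperFilter F) (f g : R -> H) a b :
  f @ F --> a -> g @ F --> b -> dot (f t) (g t) @[t --> F] --> dot a b.
Proof.
have E u v : dot u v = (`|u + v| ^+ 2 - `|u - v| ^+ 2) / 4.
  by rewrite -!(dotvv Hdot) !dotE (dotC _ v u); lra.
move=> fa gb; rewrite E; under eq_cvg do rewrite E.
apply: cvgMr_tmp; apply: cvgB; rewrite ?expr2; apply: cvgM; apply: cvg_norm.
- exact: cvgD.
- exact: cvgD.
- exact: cvgB.
- exact: cvgB.
Qed.

Lemma is_derive_dot (f g : R -> H) (t : R) df dg :
  is_derive t (1 : R) f df -> is_derive t (1 : R) g dg ->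
  is_derive t (1 : R) (fun s => dot (f s) (g s)) (dot df (g t) + dot (f t) dg).
Proof.
apply: (@is_derive_bilinear R H H R (fun u v => dot u v)).
- by move=> u u' v; exact: dotDl.
- by move=> u v v'; exact: dotDr.
- by move=> c u v; exact: dotZl.
- by move=> c u v; exact: dotZr.
- exact: cvg_dot.
Qed.

End DeriveDot.

Section DeriveReal.
Context (R : realType) (V : normedModType R).

Lemma is_derive_addf (f g : R -> V) (t : R) df dg :
  is_derive t (1 : R) f df -> is_derive t (1 : R) g dg ->
  is_derive t (1 : R) (fun s => f s + g s) (df + dg).
Proof. exact: is_deriveD. Qed.

Lemma is_derive_subf (f g : R -> V) (t : R) df dg :
  is_derive t (1 : R) f df -> is_derive t (1 : R) g dg ->
  is_derive t (1 : R) (fun s => f s - g s) (df - dg).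
Proof. exact: is_deriveB. Qed.

Lemma is_derive_mulf (f g : R -> R) (t df dg : R) :
  is_derive t (1 : R) f df -> is_derive t (1 : R) g dg ->
  is_derive t (1 : R) (fun s => f s * g s) (df * g t + f t * dg).
Proof. exact: is_derive_scale. Qed.

End DeriveReal.

(** * The energy and its exact derivative *)

Section Energy.
Context (R : realType) (H : completeNormedModType R) (dot : {dot H for idfun}).
Hypothesis Hdot : norm_from_dot dot.
Variables (g : H -> R) (alpha beta : R) (xs : H) (eps : R -> R) (x x' : R -> H).
Hypothesis g_diff2 : twice_differentiable dot g.

Let p := alpha / 3 - 1.
Let lam := 2 / 3 * alpha.
Let G z := gradient dot g z.
Let v t := lam *: (x t - xs) + t *: (x' t + beta *: G (x t)).

Definition energy t := t `^ p *
  ((t ^+ 2 - beta * t) * (g (x t) - g xs)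
   + t ^+ 2 * eps t / 2 * (dot (x t) (x t) - dot xs xs)
   + 2^-1 * dot (v t) (v t)).

(** The derivative of [energy] divided by t^p, with the acceleration eliminated through the
    equation; [e'] stands for the derivative of [eps]. The only product involving the velocity that
    survives is its squared norm. *)
Definition energy_rate t e' :=
  let z := x t - xs in let phi := g (x t) - g xs in let Gx := G (x t) in
  ((p + 2) * t - beta * (p + 1)) * phi
  + ((p + 2) * t * eps t + t ^+ 2 * e') / 2 * (dot (x t) (x t) - dot xs xs)
  + p * lam ^+ 2 / (2 * t) * dot z z
  - t * (alpha - 3) / 6 * dot (x' t) (x' t)
  + (lam * (beta - t) + p * lam * beta) * dot Gx z
  + ((beta - t) * t * beta + p * t * beta ^+ 2 / 2) * dot Gx Gx
  - t * eps t * lam * dot (x t) z - t ^+ 2 * eps t * beta * dot (x t) Gx.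

Lemma is_derive_energy (t : R) (x'' : H) (e' : R) : 0 < t ->
  is_derive t (1 : R) x (x' t) -> is_derive t (1 : R) x' x'' ->
  is_derive t (1 : R) eps e' ->
  x'' + (alpha / t) *: x' t + beta *: hessian dot g (x t) (x' t)
    + gradient dot g (x t) + eps t *: x t = 0 ->
  is_derive t (1 : R) energy (t `^ p * energy_rate t e').
Proof.
move=> t0 dx dx' de ode.
have dI : is_derive t (1 : R) (fun s : R => s) 1 by exact: is_derive_id.
have dc (V : normedModType R) (c : V) : is_derive t (1 : R) (fun _ : R => c) 0.
  exact: is_derive_cst.
have dg : is_derive t (1 : R) (fun s => g (x s)) (dot (G (x t)) (x' t)).
  rewrite /G -(gradientP Hdot); last exact: (g_diff2 _).1.
  exact: is_derive_comp_diff (g_diff2 _).1 dx.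
have dG : is_derive t (1 : R) (fun s => G (x s)) (hessian dot g (x t) (x' t)).
  exact: is_derive_comp_diff (g_diff2 _).2 dx.
(* The gradient inside [v] contributes the Hessian term that accompanies the acceleration in the
   equation, so the two are replaced together and no Hessian is left. *)
pose v' := (lam + 1 - alpha) *: x' t + (beta - t) *: G (x t) - (t * eps t) *: x t.
have dv : is_derive t (1 : R) v v'.
  have h1 := is_derive_scale (dc _ lam) (is_derive_subf dx (dc _ xs)).
  have h2 := is_derive_scale dI (is_derive_addf dx' (is_derive_scale (dc _ beta) dG)).
  apply: (is_derive_eq (is_derive_addf h1 h2)).
  have -> : x'' + (0 *: G (x t) + beta *: hessian dot g (x t) (x' t)) =
      - ((alpha / t) *: x' t + G (x t) + eps t *: x t).
    apply/eqP; rewrite -subr_eq0 opprK -ode scale0r add0r /G; apply/eqP.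
    rewrite !addrA; do 2 congr (_ + _).
    by rewrite addrAC.
  rewrite !scale0r !add0r subr0 scale1r scalerN !scalerDr !scalerA.
  rewrite (_ : t * (alpha / t) = alpha); last by field; lra.
  rewrite /v' !scalerBl !scalerDl !scale1r !opprD !addrA.
  congr (_ - _); rewrite -!addrA; congr (_ + (_ + _)).
  by rewrite [in RHS]addrCA.
have dpow : is_derive t (1 : R) (fun s => s `^ p) (t `^ p * (p / t)).
  apply: (is_derive_eq (is_derive1_powR p t0)).
  by rewrite powRB ?(gt_eqF t0) ?implybT// powRr1 ?(ltW t0)//; field; lra.
have dt2 : is_derive t (1 : R) (fun s : R => s ^+ 2) (t + t).
  by apply: (is_derive_eq (is_derive_mulf dI dI)); rewrite mulr1 mul1r.
have dxx := is_derive_dot Hdot dx dx.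
have dvv := is_derive_dot Hdot dv dv.
have h1 := is_derive_mulf (is_derive_subf dt2 (is_derive_mulf (dc _ beta) dI))
              (is_derive_subf dg (dc _ (g xs))).
have h2 := is_derive_mulf (is_derive_mulf (is_derive_mulf dt2 de) (dc _ (2^-1 : R)))
             (is_derive_subf dxx (dc _ (dot xs xs))).
have h3 := is_derive_mulf (dc _ (2^-1 : R)) dvv.
apply: (is_derive_eq (is_derive_mulf dpow (is_derive_addf (is_derive_addf h1 h2) h3))).
rewrite -mulrA -mulrDr; congr (_ * _).
rewrite /v' /v /energy_rate /= -/(G _).
move: (G (x t)) => Gx; move: (x' t) (x t) => y X.
rewrite !dotE.
(* Each symmetric product gets a single orientation, so that [field] sees one atom per pair. *)
rewrite (dotC _ xs X) (dotC _ y X) (dotC _ Gx X) (dotC _ y xs) (dotC _ Gx xs) (dotC _ Gx y).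
rewrite /lam /p; field; lra.
Qed.

End Energy.

(** * Upper bounds for the energy rate *)

Section EnergyBound.
Context (R : realType) (H : completeNormedModType R) (dot : {dot H for idfun}).
Hypothesis Hdot : norm_from_dot dot.
Variables (g : H -> R) (alpha beta : R) (xs : H) (eps : R -> R) (x x' : R -> H).
Hypothesis g_diff2 : twice_differentiable dot g.
Hypothesis g_convex : convex_function [set: convex_lmodType H] g.
Hypothesis g_min : forall z, g xs <= g z.
Hypotheses (alpha_ge3 : 3 <= alpha) (beta_ge0 : 0 <= beta).

Let p := alpha / 3 - 1.
Let lam := 2 / 3 * alpha.

Lemma gap_le_dot z : g z - g xs <= dot (gradient dot g z) (z - xs).
Proof.
have := convex_gradient_le Hdot g_convex xs (g_diff2 z).1.
by rewrite -(opprB z xs) dotNr; lra.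
Qed.

Lemma young_dot (r : R) u v : 0 < r -> dot u v <= r * dot u u + dot v v / (4 * r).
Proof.
move=> r0; have := dot_ge0 dot ((2 * r) *: u - v).
rewrite !dotE (dotC _ v u) => h.
have : 0 <= (4 * r)^-1 * (2 * r * (2 * r * dot u u) - 2 * r * dot u v
    - (2 * r * dot u v - dot v v)).
  by apply: mulr_ge0; [rewrite invr_ge0; lra|lra].
rewrite -subr_ge0; congr (_ <= _); field; lra.
Qed.

(* What is left of [energy_rate] once convexity and Young's inequality have been used; for
   [alpha > 3] all three coefficients are eventually nonpositive, while for [alpha = 3] that
   of [g (x t) - g xs] is [beta >= 0] and has to be absorbed by the other two. *)
Definition energy_defect a t :=
  let z := x t - xs in let Gx := gradient dot g (x t) in
  (- p * t + beta * (p + 1) * (lam - 1)) * (g (x t) - g xs)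
  + (p * lam ^+ 2 / (2 * t) - t * eps t * lam / 2) * dot z z
  + (- beta * t ^+ 2 + beta ^+ 2 * t * (1 + p / 2) + beta * t ^+ 2 / a) * dot Gx Gx.

(** The right side minus the left is exactly [s1 + s2 + s3 - r], with [r] the defect: [s1] is
    Young's inequality for eps <x, G>, [s2] is convexity with a weight made nonnegative by
    [beta * (p + 1) <= t], and [s3] is the kinetic term, nonnegative as [alpha >= 3]. *)
Lemma energy_rate_le (a t e' : R) : 0 < t -> 0 <= eps t -> 1 < a ->
  beta * (p + 1) <= t ->
  energy_defect a t <= 0 ->
  energy_rate dot g alpha beta xs eps x x' t e' <=
  (- p * t * eps t + t ^+ 2 * e') / 2 * (dot (x t) (x t) - dot xs xs)
  + a * beta / 4 * t ^+ 2 * eps t ^+ 2 * dot (x t) (x t).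
Proof.
have al3 := alpha_ge3.
move=> t0 e0 a1 tb; have lam0 : 0 <= lam by rewrite /lam; lra.
rewrite /energy_defect/=.
set G := gradient dot g (x t); set z := x t - xs => res.
(* As [lam = 2 (p + 1)], this turns the coefficient [p + 2] of t eps (|x|^2 - |xs|^2)/2 into [- p],
   and it produces the negative |z|^2 term of the defect. *)
have xzE : dot (x t) z = (dot (x t) (x t) - dot xs xs + dot z z) / 2.
  by rewrite /z !dotE (dotC _ xs (x t)); field.
have S1 : 0 <= beta * t ^+ 2 * (a * eps t ^+ 2 / 4 * dot (x t) (x t) + dot G G / a
    + eps t * dot (x t) G).
  apply: mulr_ge0; first by apply: mulr_ge0 => //; exact: sqr_ge0.
  have := dot_ge0 dot ((a * eps t / 2) *: x t + G).
  rewrite !dotE (dotC _ G (x t)) => h.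
  have : 0 <= a^-1 * (a * eps t / 2 * (a * eps t / 2 * dot (x t) (x t) + dot (x t) G)
      + (a * eps t / 2 * dot (x t) G + dot G G)).
    by rewrite mulr_ge0 ?invr_ge0//; lra.
  by congr (_ <= _); field; lra.
have S2 : 0 <= lam * (t - beta * (p + 1)) * (dot G z - (g (x t) - g xs)).
  apply: mulr_ge0; last by rewrite subr_ge0 gap_le_dot.
  by apply: mulr_ge0; [exact: lam0|rewrite subr_ge0].
have S3 : 0 <= t * (alpha - 3) / 6 * dot (x' t) (x' t).
  apply: mulr_ge0; last exact: dot_ge0.
  by apply: divr_ge0 => //; apply: mulr_ge0; lra.
rewrite /energy_rate -/G -/z xzE -/p -/lam.
move: (dot (x t) (x t)) (dot xs xs) (dot z z) (dot (x t) G) (dot G G) (dot G z)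
  (dot (x' t) (x' t)) (g (x t) - g xs) {xzE} S1 S2 S3 res => xx ss zz xG GG Gz yy phi.
set s1 := (X in 0 <= X -> _); set s2 := (X in _ -> 0 <= X -> _).
set s3 := (X in _ -> _ -> 0 <= X -> _); set r := (X in _ -> _ -> _ -> X <= 0 -> _).
move=> S1 S2 S3 res.
rewrite -subr_ge0 (_ : _ - _ = s1 + s2 + s3 - r); first lra.
by rewrite /s1 /s2 /s3 /r /lam /p; field; lra.
Qed.

(** The last three hypotheses make the coefficients of |z|^2, of the gap of [g] and of |G|^2
    nonpositive, in this order. *)
Lemma energy_defect_le0_gt3 (a t : R) : 1 < a -> 0 < t ->
  p * lam <= t ^+ 2 * eps t -> beta * (p + 1) * (lam - 1) <= p * t ->
  beta * (1 + p / 2) <= t * (1 - a^-1) -> energy_defect a t <= 0.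
Proof.
have al3 := alpha_ge3; have be0 := beta_ge0.
move=> a1 t0 h1 h2 h3; rewrite /energy_defect/=.
set G := gradient dot g (x t); set z := x t - xs.
have lam0 : 0 <= lam by rewrite /lam; lra.
have S1 : 0 <= (p * t - beta * (p + 1) * (lam - 1)) * (g (x t) - g xs).
  by apply: mulr_ge0; rewrite subr_ge0.
have S2 : 0 <= (t ^+ 2 * eps t - p * lam) * (lam / (2 * t)) * dot z z.
  apply: mulr_ge0; last exact: dot_ge0.
  by apply: mulr_ge0; rewrite ?subr_ge0// divr_ge0//; lra.
have S3 : 0 <= beta * t * (t * (1 - a^-1) - beta * (1 + p / 2)) * dot G G.
  apply: mulr_ge0; last exact: dot_ge0.
  by apply: mulr_ge0; rewrite ?subr_ge0// mulr_ge0// ltW.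
move: S1 S2 S3; set s1 := (X in 0 <= X -> _); set s2 := (X in _ -> 0 <= X -> _).
set s3 := (X in _ -> _ -> 0 <= X -> _) => S1 S2 S3.
rewrite [leLHS](_ : _ = - (s1 + s2 + s3)); first lra.
by rewrite /s1 /s2 /s3; field; rewrite !gt_eqF//; lra.
Qed.

(** Here [p = 0] and [lam = 2], and the gap is at most <G, z>, which Young's inequality splits with
    weight k t^2. Half of the margin [1 - a^-1 = 2 k] absorbs the |G|^2 part of this, the other half
    the term in [beta ^+ 2]; the |z|^2 part is absorbed by t eps |z|^2. *)
Lemma energy_defect_le0_eq3 (a t : R) (k := (1 - a^-1) / 2) : alpha = 3 ->
  1 < a -> 1 <= t -> beta <= t * k -> beta / (4 * k) <= t ^+ 2 * eps t ->
  energy_defect a t <= 0.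
Proof.
move=> al3 a1 t1 h1 h2.
have be0 := beta_ge0.
have a0 : a^-1 < 1 by rewrite invf_lt1; lra.
have k0 : 0 < k by rewrite /k; lra.
have t0 : 0 < t by lra.
have kt : 0 < k * t ^+ 2 by rewrite mulr_gt0// exprn_gt0.
rewrite /energy_defect/=; have := gap_le_dot (x t).
set G := gradient dot g (x t); set z := x t - xs => gap.
have yg := young_dot G z kt.
have S1 : 0 <= beta * (k * t ^+ 2 * dot G G + dot z z / (4 * (k * t ^+ 2)) - (g (x t) - g xs)).
  by apply: mulr_ge0 => //; lra.
have S2 : 0 <= beta * t * (t * k - beta) * dot G G.
  apply: mulr_ge0; last exact: dot_ge0.
  by apply: mulr_ge0; rewrite ?subr_ge0// mulr_ge0// ltW.
have S3 : 0 <= (t * (t ^+ 2 * eps t - beta / (4 * k)) + (t - 1) * (beta / (4 * k)))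
    / t ^+ 2 * dot z z.
  apply: mulr_ge0; last exact: dot_ge0.
  apply: divr_ge0; last exact: sqr_ge0.
  apply: addr_ge0; apply: mulr_ge0; rewrite ?subr_ge0 ?(ltW t0)//.
  by apply: divr_ge0 => //; lra.
move: S1 S2 S3; set s1 := (X in 0 <= X -> _); set s2 := (X in _ -> 0 <= X -> _).
set s3 := (X in _ -> _ -> 0 <= X -> _) => S1 S2 S3.
have ai : a^-1 = 1 - 2 * k by rewrite /k; field; lra.
rewrite ai [leLHS](_ : _ = - (s1 + s2 + s3)); first lra.
rewrite /s1 /s2 /s3 /lam /p al3; field.
by rewrite !gt_eqF.
Qed.

Lemma near_energy_defect_le0 (a : R) : 1 < a ->
  (alpha = 3 -> t ^+ 2 * eps t @[t --> +oo] --> +oo) ->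
  (3 < alpha -> \forall t \near +oo, p * lam <= t ^+ 2 * eps t) ->
  \forall t \near +oo, energy_defect a t <= 0.
Proof.
move=> a1 eq3 gt3; have al3 := alpha_ge3.
have a0 : a^-1 < 1 by rewrite invf_lt1; lra.
have [/eqP al|al] := boolP (alpha == 3).
  near=> t; apply: energy_defect_le0_eq3 => //.
  - by rewrite -ler_pdivrMr ?divr_gt0 ?subr_gt0//; near: t; exact: nbhs_pinfty_ge.
  - by near: t; move/cvgryPge : (eq3 al); exact.
have {}al : 3 < alpha by rewrite lt_neqAle eq_sym al.
have p0 : 0 < p by rewrite /p; lra.
near=> t; apply: energy_defect_le0_gt3 => //.
- by near: t; exact: gt3.
- by rewrite mulrC -ler_pdivrMl//; near: t; exact: nbhs_pinfty_ge.
- by rewrite -ler_pdivrMr ?subr_gt0//; near: t; exact: nbhs_pinfty_ge.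
Unshelve. all: by end_near. Qed.

End EnergyBound.

(** * Monotonicity, one-sided continuity, integrals and powers on the real line *)

Lemma derive_le0_nonincreasing (R : realType) (f : R -> R) (a : R) :
  (forall t, a <= t -> exists2 d, is_derive t (1 : R) f d & d <= 0) ->
  forall t, a <= t -> f t <= f a.
Proof.
move=> df t ta; apply: (ler0_derive1_nincry (a := a)) => // [s|s|].
- by rewrite in_itv/= andbT => /ltW /df[d []].
- by rewrite in_itv/= andbT derive1E => /ltW /df[d [_ ->]].
- apply/continuous_in_subspaceT => s.
  by rewrite inE/= in_itv/= andbT => /df[d /is_derive_continuous].
Qed.

Lemma near_pinfty_ge (R : realType) (P : set R) : (\forall t \near +oo, P t) ->
  exists T : R, forall t, T <= t -> P t.
Proof.
move=> [M [_ MP]]; exists (M + 1) => t Mt; apply: MP.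
by apply: lt_le_trans Mt; rewrite ltrDl.
Qed.

(** Relative differentiability gives relative continuity, by f(s) = (s - t) q(s) + f(t) with [q] the
    quotient. It serves at the endpoint of the time interval. *)
Lemma derivable_within_cvg (R : realType) (V : normedModType R) (A : set R)
    (f : R -> V) (t : R) :
  derivable_within A f t -> f s @[s --> within A t^'] --> f t.
Proof.
set F := within A t^'; move=> /= df.
have FF : Filter F by exact: within_filter.
have st : s - t @[s --> F] --> 0.
  rewrite -(subrr t); apply: cvgB; last exact: cvg_cst.
  by apply: cvg_within_filter; apply: cvg_within_filter; exact: cvg_id.
have h := @cvgD _ _ _ _ FF _ _ _ _ (@cvgZ _ _ _ _ FF _ _ _ _ st df) (@cvg_cst _ (f t) _ F FF).
rewrite scale0r add0r in h; apply: cvg_trans h; apply: near_eq_cvg.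
rewrite /F !near_withinE; apply: nearW => s sNt _ /=.
rewrite (_ : _ s = (s - t) *: ((s - t)^-1 *: (f s - f t)) + f t)//.
by rewrite scalerA divff ?subr_eq0// scale1r subrK.
Qed.

Lemma is_derive_integral (R : realType) (f : R -> R) (a t : R) : a < t ->
  (forall s, a < s -> {for s, continuous f}) -> f s @[s --> a^'+] --> f a ->
  is_derive t (1 : R) (fun u => \int[lebesgue_measure]_(s in `[a, u]) f s) (f t).
Proof.
move=> at' fc fa.
(* The interval extends beyond [t] to make [t] an interior point for the fundamental theorem of
   calculus. *)
have fint : lebesgue_measure.-integrable `[a, t + 1] (EFin \o f).
  have at1 : a < t + 1 by rewrite ltr_wpDr.
  apply: continuous_compact_integrable; first exact: segment_compact.
  apply/continuous_within_itvP => //; split=> //.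
    by move=> s; rewrite in_itv/= => /andP[+ _]; exact: fc.
  by apply: cvg_at_left_filter; exact: fc.
have tt1 : t < t + 1 by rewrite ltrDl.
have [D1 D2] := continuous_FTC1_closed tt1 fint at' (fc _ at').
by split=> //; rewrite -derive1E.
Qed.

Lemma powR_cvgy (R : realType) (p : R) : 0 < p -> t `^ p @[t --> +oo] --> +oo.
Proof.
move=> p0; apply/cvgryPge => M.
near=> t.
have M0 : 0 <= Num.max M 0 by rewrite le_max lexx orbT.
apply: (@le_trans _ _ (Num.max M 0)); first by rewrite le_max lexx.
rewrite -[leLHS]powRr1// -(mulVf (lt0r_neq0 p0)) powRrM.
apply: ge0_ler_powR; rewrite ?nnegrE ?powR_ge0 ?(ltW p0)//; near: t; exact: nbhs_pinfty_ge.
Unshelve. all: by end_near. Qed.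

(** * Asymptotic estimates along the trajectory *)

Section Dynamics.
Context (R : realType) (H : completeNormedModType R) (dot : {dot H for idfun}).
Hypothesis Hdot : norm_from_dot dot.
Variables (g : H -> R) (xs : H) (eps eps' : R -> R) (x x' x'' : R -> H).
Hypothesis g_diff2 : twice_differentiable dot g.
Hypothesis g_convex : convex_function [set: convex_lmodType H] g.
Hypothesis g_min : forall z, g xs <= g z.
Hypothesis eps_ge0 : \forall t \near +oo, 0 <= eps t.
Hypothesis deps : \forall t \near +oo, is_derive t (1 : R) eps (eps' t).

Let xx t := dot (x t) (x t).
Let ss := dot xs xs.

Definition energy_dissipates (alpha beta a : R) :=
  let p := alpha / 3 - 1 in
  \forall t \near +oo,
    exists2 dE, is_derive t (1 : R) (energy dot g alpha beta xs eps x x') (t `^ p * dE) &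
    dE <= (- p * t * eps t + t ^+ 2 * eps' t) / 2 * (xx t - ss)
          + a * beta / 4 * t ^+ 2 * eps t ^+ 2 * xx t.

Lemma energy_dissipatesP (alpha beta a : R) (p := alpha / 3 - 1)
    (lam := 2 / 3 * alpha) :
  3 <= alpha -> 0 <= beta -> 1 < a ->
  (\forall t \near +oo, is_derive t (1 : R) x (x' t)) ->
  (\forall t \near +oo, is_derive t (1 : R) x' (x'' t)) ->
  (\forall t \near +oo,
    x'' t + (alpha / t) *: x' t + beta *: hessian dot g (x t) (x' t)
      + gradient dot g (x t) + eps t *: x t = 0) ->
  (alpha = 3 -> t ^+ 2 * eps t @[t --> +oo] --> +oo) ->
  (3 < alpha -> \forall t \near +oo, p * lam <= t ^+ 2 * eps t) ->
  energy_dissipates alpha beta a.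
Proof.
move=> al3 be0 a1 dx dx' ode eq3 gt3; rewrite /energy_dissipates /=.
have defect_le0 : \forall t \near +oo, energy_defect dot g alpha beta xs eps x a t <= 0.
  exact: (near_energy_defect_le0 Hdot).
near=> t.
have tp : 0 < t by [].
exists (energy_rate dot g alpha beta xs eps x x' t (eps' t)).
  have dxt : is_derive t (1 : R) x (x' t) by near: t; exact: dx.
  have dx't : is_derive t (1 : R) x' (x'' t) by near: t; exact: dx'.
  have dept : is_derive t (1 : R) eps (eps' t) by near: t; exact: deps.
  by apply: (is_derive_energy Hdot xs g_diff2 tp dxt dx't dept); near: t; exact: ode.
apply: (energy_rate_le Hdot) => //.
- by near: t; exact: eps_ge0.
- by near: t; exact: defect_le0.
Unshelve. all: by end_near. Qed.

Let dpow (t q : R) : 0 < t -> is_derive t (1 : R) (fun s => s `^ q) (t `^ q * (q / t)).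
Proof.
move=> tp; apply: (is_derive_eq (is_derive1_powR q tp)).
by rewrite powRB ?(gt_eqF tp) ?implybT// powRr1 ?(ltW tp)//; field; lra.
Qed.

Let dsqr (t : R) : is_derive t (1 : R) (fun s : R => s ^+ 2) (2 * t).
Proof.
have dI : is_derive t (1 : R) (fun s : R => s) 1 by exact: is_derive_id.
by apply: (is_derive_eq (is_derive_mulf dI dI)); ring.
Qed.

(** The square |v|^2/2 is dropped, and t^2 - beta t >= t^2/2 once [t >= 2 beta]. *)
Let energy_ge (alpha beta t : R) : 0 < t -> 2 * beta <= t ->
  t `^ (alpha / 3 - 1) * t ^+ 2 * ((g (x t) - g xs) / 2 + eps t / 2 * (xx t - ss))
  <= energy dot g alpha beta xs eps x x' t.
Proof.
move=> tp bt; rewrite /energy -mulrA ler_pM2l ?powR_gt0//.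
set v := (X in 2^-1 * dot X _); have vv : 0 <= dot v v by exact: dot_ge0.
have : 0 <= (t ^+ 2 / 2 - beta * t) * (g (x t) - g xs).
  apply: mulr_ge0; rewrite ?subr_ge0//.
  have : 0 <= t * (t - 2 * beta) by apply: mulr_ge0; [exact: ltW|rewrite subr_ge0].
  by lra.
by rewrite /xx /ss; move: (dot v v) vv (dot (x t) (x t)) (dot xs xs) => A vv B C; lra.
Qed.

(** A corrected energy [F] is nonincreasing wherever the trajectory is, and it dominates t^(p+2)
    times half the gap of [g] minus a small constant; as this weight is at least [t], the gap
    becomes small. *)
Lemma values_cvg (alpha beta a eta : R) : 3 <= alpha ->
  eps t @[t --> +oo] --> (0 : R) ->
  (\forall t \near +oo, eps' t <= - (a * beta / 2) * eps t ^+ 2) ->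
  energy_dissipates alpha beta a ->
  0 < eta -> \forall t \near +oo, g (x t) <= g xs + eta.
Proof.
move=> al3 eps_lim eps_decay; rewrite /energy_dissipates.
set p := alpha / 3 - 1; set E := energy dot g alpha beta xs eps x x' => /= Edecay eta0.
have p_ge0 : 0 <= p by rewrite /p; lra.
have alg1 (m f d y s c : R) : 0 <= m * (d / 2 * y) ->
  m * (f / 2 - s * c) <= m * (f / 2 + d / 2 * (y - s)) + s * (m * (d * 2^-1 - c)).
  by lra.
have ss0 : 0 <= ss by exact: dot_ge0.
(* This makes [ss * e <= eta / 4]; the added 1 covers [xs = 0]. *)
pose e := eta / (4 * (ss + 1)).
have e0 : 0 < e by apply: divr_gt0 => //; lra.
have [T TP] : exists T : R, forall t, T <= t ->
    [/\ [/\ is_derive t (1 : R) eps (eps' t), 1 <= t & 2 * beta <= t], 0 <= eps t <= e,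
        eps' t <= - (a * beta / 2) * eps t ^+ 2 &
        exists2 dE, is_derive t (1 : R) E (t `^ p * dE) &
        dE <= (- p * t * eps t + t ^+ 2 * eps' t) / 2 * (xx t - ss)
          + a * beta / 4 * t ^+ 2 * eps t ^+ 2 * xx t].
  apply: near_pinfty_ge; near=> t; split.
  - by split=> //; near: t; exact: deps.
  - apply/andP; split; first by near: t; exact: eps_ge0.
    near: t; have /cvgrPdist_le/(_ _ e0) := eps_lim; apply: filterS => t.
    by rewrite sub0r normrN; exact/le_trans/ler_norm.
  - by near: t; exact: eps_decay.
  - by near: t; exact: Edecay.
(* The part in [eps] cancels the derivative of [eps] multiplying |xs|^2; the part in [e] outweighs
   the remaining multiples of [eps t], which is at most [e]. *)
pose F t := E t + ss * (t `^ p * (t ^+ 2 * (eps t * 2^-1 - e))).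
have FT t : T <= t -> F t <= F T.
  apply: derive_le0_nonincreasing => {}t /TP[[de t1 _] /andP[et0 et] e't [dE dEP dEle]].
  have tp : 0 < t by lra.
  have dc (c : R) : is_derive t (1 : R) (fun _ : R => c) 0 by exact: is_derive_cst.
  have h := is_derive_mulf (dsqr t)
    (is_derive_subf (is_derive_mulf de (dc 2^-1)) (dc e)).
  eexists.
    exact: is_derive_addf dEP (is_derive_mulf (dc ss) (is_derive_mulf (dpow p tp) h)).
  set d := (X in X <= 0).
  have -> : d = t `^ p * (dE + ss * ((p + 2) * t * (eps t / 2 - e) + t ^+ 2 * eps' t / 2)).
    by rewrite /d; field; lra.
  rewrite pmulr_rle0 ?powR_gt0//.
  have xx0 : 0 <= xx t by exact: dot_ge0.
  (* The decay condition on [eps] gives all |x|^2 terms a favourable sign, so no bound on the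
     trajectory enters. *)
  have S1 : 0 <= t ^+ 2 * xx t * (- eps' t - a * beta / 2 * eps t ^+ 2).
    apply: mulr_ge0; first by apply: mulr_ge0 => //; exact: sqr_ge0.
    by lra.
  have S2 : 0 <= p * t * eps t * xx t.
    by do 3 apply: mulr_ge0 => //; exact: ltW.
  have S3 : 0 <= ss * (t * (p + 1) * (e - eps t)).
    apply: mulr_ge0 => //; apply: mulr_ge0; last by rewrite subr_ge0.
    by apply: mulr_ge0; lra.
  have S4 : 0 <= ss * (t * e) by do 2 apply: mulr_ge0 => //; exact: ltW.
  lra.
near=> t.
have Tt : T <= t by [].
have [[_ t1 bt] /andP[et0 _] _ _] := TP _ Tt.
have tp : 0 < t by lra.
pose m := t `^ p * t ^+ 2.
have m1 : t <= m.
  rewrite /m -[leLHS]mul1r ler_pM ?ler_eXpr// ?(ltW tp)//.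
    by rewrite -(powRr0 t) ler_powR.
  by rewrite expr2 ler_peMl// ltW.
have m0 : 0 < m by lra.
have h3 : m * ((g (x t) - g xs) / 2 - ss * e) <= `|F T|.
  have h1 := energy_ge alpha tp bt; have h2 := FT _ Tt.
  rewrite (le_trans _ (ler_norm _))// (le_trans _ h2)// /F.
  rewrite (le_trans _ (lerD h1 (lexx _)))//.
  have : 0 <= m * (eps t / 2 * xx t).
    apply: mulr_ge0; first exact: ltW.
    by apply: mulr_ge0; [exact: divr_ge0|exact: dot_ge0].
  rewrite [t `^ p * _]mulrA -/m; exact: alg1.
have h4 : (g (x t) - g xs) / 2 - ss * e <= eta / 4.
  rewrite -(ler_pM2l m0) (le_trans h3)//.
  have : 4 * `|F T| / eta <= t by [].
  rewrite ler_pdivrMr// => h5.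
  have : t * eta <= m * eta by rewrite ler_pM2r.
  by lra.
have h6 : ss * e <= eta / 4.
  rewrite /e mulrA ler_pdivrMr; last lra.
  have := mulr_ge0 (ltW eta0) ss0; lra.
lra.
Unshelve. all: by end_near. Qed.

(** Outside the ball |x|^2 - |xs|^2 >= 0, so only the |xs|^2 part of the Young remainder can make
    the energy grow, and it integrates to a multiple of [I]. Dividing by t^(p+2) eps makes both the
    initial energy and [I] negligible. *)
Lemma regularized_gap_le (alpha beta a eta : R) (I : R -> R) (p := alpha / 3 - 1) :
  3 <= alpha -> 0 <= beta -> 0 < a ->
  (\forall t \near +oo, eps' t <= - (a * beta / 2) * eps t ^+ 2) ->
  energy_dissipates alpha beta a ->
  t `^ p * t ^+ 2 * eps t @[t --> +oo] --> +oo ->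
  (\forall t \near +oo, is_derive t (1 : R) I (t `^ p * t ^+ 2 * eps t ^+ 2)) ->
  beta / (t `^ p * t ^+ 2 * eps t) * I t @[t --> +oo] --> (0 : R) ->
  (\forall t \near +oo, `|xs| <= `|x t|) ->
  0 < eta -> \forall t \near +oo,
    g (x t) - g xs + eps t * (`|x t| ^+ 2 - `|xs| ^+ 2) <= eta * eps t.
Proof.
move=> al3 be0 a0 eps_decay; rewrite /energy_dissipates -/p.
set E := energy dot g alpha beta xs eps x x' => /= Edecay weight_cvg dI I_cvg outside eta0.
have p_ge0 : 0 <= p by rewrite /p; lra.
have ss0 : 0 <= ss by exact: dot_ge0.
have [T TP] : exists T : R, forall t, T <= t ->
    [/\ [/\ is_derive t (1 : R) I (t `^ p * t ^+ 2 * eps t ^+ 2), 1 <= t & 2 * beta <= t],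
        0 <= eps t /\ 0 <= xx t - ss,
        eps' t <= - (a * beta / 2) * eps t ^+ 2 &
        exists2 dE, is_derive t (1 : R) E (t `^ p * dE) &
        dE <= (- p * t * eps t + t ^+ 2 * eps' t) / 2 * (xx t - ss)
          + a * beta / 4 * t ^+ 2 * eps t ^+ 2 * xx t].
  apply: near_pinfty_ge; near=> t; split.
  - by split=> //; near: t; exact: dI.
  - split; first by near: t; exact: eps_ge0.
    rewrite /xx /ss !(dotvv Hdot) subr_ge0 ler_sqr ?nnegrE//.
    by near: t; exact: outside.
  - by near: t; exact: eps_decay.
  - by near: t; exact: Edecay.
have alg1 (f n d y m : R) : `|f| <= n / 4 * (m * d) -> y <= n / 4 * (m * d) ->
  f + y <= m * (n / 2 * d).
  by move=> h1 h2; have := ler_norm f; lra.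
pose c := a * beta / 4 * ss.
pose F t := E t - c * I t.
have FT t : T <= t -> F t <= F T.
  apply: derive_le0_nonincreasing => {}t /TP[[dIt t1 _] [et0 out] e't [dE dEP dEle]].
  have tp : 0 < t by lra.
  have dc (b : R) : is_derive t (1 : R) (fun _ : R => b) 0 by exact: is_derive_cst.
  eexists.
    exact: is_derive_subf dEP (is_derive_mulf (dc c) dIt).
  set d := (X in X <= 0).
  have -> : d = t `^ p * (dE - c * (t ^+ 2 * eps t ^+ 2)) by rewrite /d; ring.
  rewrite pmulr_rle0 ?powR_gt0// /c.
  have S1 : 0 <= t ^+ 2 * (xx t - ss) * (- eps' t - a * beta / 2 * eps t ^+ 2).
    apply: mulr_ge0; last by lra.
    by apply: mulr_ge0 => //; exact: sqr_ge0.
  have S2 : 0 <= p * t * eps t * (xx t - ss).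
    by do 3 apply: mulr_ge0 => //; exact: ltW.
  move: (xx t) (ss) S1 S2 dEle => A B S1 S2 dEle.
  lra.
(* Chosen so that [a * ss / 4 * e <= eta / 4], the share of [eta] left to [c * I t]; [F T] takes
   another quarter. *)
pose e := 2 * eta / (a * (ss + 1)) / 2.
have e0 : 0 < e by rewrite /e !divr_gt0 ?mulr_gt0//; lra.
near=> t.
have Tt : T <= t by [].
have [[_ t1 bt] [et0 _] _ _] := TP _ Tt.
have tp : 0 < t by lra.
pose m := t `^ p * t ^+ 2.
pose w := (g (x t) - g xs) / 2 + eps t / 2 * (`|x t| ^+ 2 - `|xs| ^+ 2).
have q1 : 4 * `|F T| / eta <= m * eps t.
  by rewrite /m; near: t; have /cvgryPge := weight_cvg; exact.
have q0 : 0 < m * eps t.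
  by rewrite /m; near: t; have /cvgryPgt := weight_cvg; exact.
have m0 : 0 < m by rewrite /m mulr_gt0 ?powR_gt0 ?exprn_gt0.
have bI : beta * I t <= e * (m * eps t).
  rewrite -ler_pdivrMr// mulrAC.
  rewrite /m; near: t; have /cvgrPdist_le/(_ _ e0) := I_cvg; apply: filterS => t.
  by rewrite sub0r normrN; exact/le_trans/ler_norm.
have cI : c * I t <= eta / 4 * (m * eps t).
  apply: (@le_trans _ _ (a * ss / 4 * (e * (m * eps t)))).
    have : 0 <= a * ss / 4 * (e * (m * eps t) - beta * I t).
      by apply: mulr_ge0; rewrite ?subr_ge0// divr_ge0// mulr_ge0// ltW.
    by rewrite /c; lra.
  rewrite mulrA ler_pM2r//.
  have -> : a * ss / 4 * e = eta / 4 * (ss / (ss + 1)).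
    by rewrite /e; field; rewrite !gt_eqF//; lra.
  rewrite ler_piMr//; first lra.
  by rewrite ler_pdivrMr; lra.
have FTm : `|F T| <= eta / 4 * (m * eps t).
  by move: q1; rewrite ler_pdivrMr//; lra.
have : m * w <= m * (eta / 2 * eps t).
  have h2 : E t <= F T + c * I t by rewrite -lerBlDr; exact: FT.
  have := energy_ge alpha tp bt; rewrite /xx /ss !(dotvv Hdot) => /le_trans; apply.
  rewrite (le_trans h2)//; apply: alg1 FTm cI.
by rewrite ler_pM2l// /w; lra.
Unshelve. all: by end_near. Qed.

End Dynamics.

(** * Growth of the weight, lower limits and the convergence theorem *)

Lemma weight_cvgy (R : realType) (p : R) (eps : R -> R) : 0 <= p ->
  (p = 0 -> t ^+ 2 * eps t @[t --> +oo] --> +oo) ->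
  (0 < p -> exists2 d, 0 < d & \forall t \near +oo, d <= t ^+ 2 * eps t) ->
  t `^ p * t ^+ 2 * eps t @[t --> +oo] --> +oo.
Proof.
move=> p0 h0 hp; apply/cvgryPge => M.
have [pE|pN0] := eqVneq p 0.
  move/cvgryPge : (h0 pE) => /(_ M); apply: filterS => t.
  by rewrite pE powRr0 mul1r.
have {}pN0 : 0 < p by rewrite lt_neqAle eq_sym pN0.
have [d d0 dP] := hp pN0.
near=> t.
have dt : d <= t ^+ 2 * eps t by near: t; exact: dP.
have Mt : `|M| / d <= t `^ p.
  by near: t; move/cvgryPge : (powR_cvgy pN0); exact.
rewrite (le_trans (ler_norm M))// -mulrA.
rewrite ler_pdivrMr// in Mt; rewrite (le_trans Mt)//.
by rewrite ler_wpM2l// powR_ge0.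
Unshelve. all: by end_near. Qed.

(** The lower limit is the supremum, over sets [V] of the filter, of the infimum of [f] on [V];
    small values inside every such [V] make each infimum at most 0. *)
Lemma limf_einf_pinfty_eq0 (R : realType) (f : R -> R) :
  (forall t, 0 <= f t) ->
  (forall d, 0 < d -> forall V, (\forall t \near +oo, V t) -> exists2 t, V t & f t <= d) ->
  limf_einf (fun t => (f t)%:E) +oo = 0%E.
Proof.
move=> f0 freq; rewrite limf_einfE; apply/le_anti/andP; split.
  apply: ge_ereal_sup => _ [V Vy <-].
  apply/lee_addgt0Pr => d d0; rewrite add0e.
  have [t Vt ft] := freq _ d0 _ Vy.
  by apply: (@le_trans _ _ (f t)%:E); [apply: ereal_inf_lbound; exists t|rewrite lee_fin].
apply: (@le_trans _ _ (ereal_inf [set (f t)%:E | t in setT])).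
  by apply: le_ereal_inf_tmp => _ [t _ <-]; rewrite lee_fin.
by apply: ereal_sup_ubound; exists setT => //; exact: filterT.
Qed.

Theorem theorem4p4 (R : realType) (H : completeNormedModType R)
  (dot : {dot H for idfun}) (Hdot : norm_from_dot dot)
  (g : H -> R)
  (g_convex : convex_function [set: convex_lmodType H] g)
  (g_diff2 : twice_differentiable dot g)
  (g_lip : forall B : set H, bounded_set B ->
     [lipschitz gradient dot g z | z in B])
  (g_argmin : argmin_on [set: H] g !=set0)
  (t0 : R) (t0_gt0 : 0 < t0)
  (eps : R -> R)
  (eps_ge0 : forall t, t0 <= t -> 0 <= eps t)
  (eps_noninc : forall s t, t0 <= s -> s <= t -> eps t <= eps s)
  (eps_C1 : C1_on `[t0, +oo[ eps)
  (eps_lim : eps t @[t --> +oo] --> (0 : R))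
  (alpha beta : R) (alpha_ge3 : 3 <= alpha) (beta_ge0 : 0 <= beta)
  (u0 v0 : H) (x : R -> H)
  (x_C2 : C2_on `[t0, +oo[ x)
  (x_ode : let x' := derive_within `[t0, +oo[ x in
           let x'' := derive_within `[t0, +oo[ x' in
     forall t, t0 <= t ->
       x'' t + (alpha / t) *: x' t + beta *: hessian dot g (x t) (x' t)
         + gradient dot g (x t) + eps t *: x t = 0)
  (x_init : x t0 = u0)
  (x'_init : derive_within `[t0, +oo[ x t0 = v0)
  (eps_int :
     (\int[lebesgue_measure]_(t in `[t0, +oo[) (eps t / t)%:E < +oo)%E)
  (eps_int_lim :
     beta / (eps t * t `^ (alpha / 3 + 1))
       * (\int[lebesgue_measure]_(s in `[t0, t])
            (eps s ^+ 2 * s `^ (alpha / 3 + 1)))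
       @[t --> +oo] --> (0 : R))
  (eps_decay : exists a t1 : R, 1 < a /\ t0 <= t1 /\
     forall t, t1 <= t ->
       derive_within `[t0, +oo[ eps t <= - (a * beta / 2) * eps t ^+ 2)
  (eps_alpha_eq3 : alpha = 3 -> t ^+ 2 * eps t @[t --> +oo] --> +oo)
  (eps_alpha_gt3 : 3 < alpha -> exists c : R, 0 < c /\
     \forall t \near +oo,
       2 / 3 * alpha * (alpha / 3 - 1 + beta * c ^+ 2) <= t ^+ 2 * eps t)
  (xs : H)
  (xs_min_norm : argmin_on (argmin_on [set: H] g) (fun z => `|z|) xs) :
  limf_einf (fun t => `|x t - xs|%:E) +oo = 0%E /\
  ((exists T : R, t0 <= T /\
      (x @` `[T, +oo[ `<=` ball 0 `|xs| \/
       x @` `[T, +oo[ `<=` ~` ball 0 `|xs|)) ->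
   `|x t - xs| @[t --> +oo] --> (0 : R)).
Proof.
have [a [t1 [a1 [t01 decay]]]] := eps_decay.
have g_min z : g xs <= g z by exact: xs_min_norm.1.2.
have g_cont : continuous g.
  by move=> z; exact: differentiable_continuous (g_diff2 z).1.
pose A := `[t0, +oo[%classic : set R.
pose x' := derive_within A x; pose x'' := derive_within A x'.
pose eps' := derive_within A eps.
(* Strictly after [t0] the relative derivatives are ordinary ones; only the integral starting at
   [t0] will need the endpoint. *)
have nbhsA t : t0 < t -> nbhs t A.
  move=> tt; apply: (@filterS _ (nbhs t) _ `]t0, +oo[).
    by move=> s; rewrite /A /= !in_itv/= !andbT => /ltW.
  by apply: open_nbhs_nbhs; split; [exact: interval_open|rewrite /= in_itv/= tt].
have inA t : t0 < t -> A t by move=> /ltW tt; rewrite /A /= in_itv/= tt.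
have dx t : t0 < t -> is_derive t (1 : R) x (x' t).
  by move=> tt; apply: is_derive_within (nbhsA _ tt) (x_C2.1.1 _ (inA _ tt)).
have dx' t : t0 < t -> is_derive t (1 : R) x' (x'' t).
  by move=> tt; apply: is_derive_within (nbhsA _ tt) (x_C2.2.1 _ (inA _ tt)).
have deps t : t0 < t -> is_derive t (1 : R) eps (eps' t).
  by move=> tt; apply: is_derive_within (nbhsA _ tt) (eps_C1.1 _ (inA _ tt)).
have near_gt (P : R -> Prop) : (forall t, t0 < t -> P t) -> \forall t \near +oo, P t.
  by move=> h; exists t0; split=> //; exact: num_real.
have near_eps_ge0 : \forall t \near +oo, 0 <= eps t.
  by apply: near_gt => t /ltW; exact: eps_ge0.
have near_deps : \forall t \near +oo, is_derive t (1 : R) eps (eps' t).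
  exact: near_gt.
have near_decay : \forall t \near +oo, eps' t <= - (a * beta / 2) * eps t ^+ 2.
  by exists t1; split; [exact: num_real|move=> t /ltW; exact: decay].
pose p := alpha / 3 - 1.
have p_ge0 : 0 <= p by rewrite /p; lra.
(* The assumed lower bound is lam (p + beta c^2), which is at least [p * lam]. *)
have eps_gt3 : 3 < alpha -> \forall t \near +oo, p * (2 / 3 * alpha) <= t ^+ 2 * eps t.
  move=> al; have [c [c0]] := eps_alpha_gt3 al; apply: filterS => t; apply: le_trans.
  rewrite mulrDr [leLHS]mulrC lerDl; apply: mulr_ge0; first lra.
  by apply: mulr_ge0 => //; exact: sqr_ge0.
have diss : energy_dissipates dot g xs eps eps' x x' alpha beta a.
  apply: (@energy_dissipatesP _ _ _ Hdot g xs eps eps' x x' x'') => //.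
  - exact: near_gt.
  - exact: near_gt.
  - by apply: near_gt => t /ltW; exact: x_ode.
have vals eta : 0 < eta -> \forall t \near +oo, g (x t) <= g xs + eta.
  exact: (values_cvg g_min near_eps_ge0 near_deps alpha_ge3 eps_lim near_decay diss).
have stable := min_norm_stable Hdot g_convex g_cont xs_min_norm.
(* The norm condition stays inside the eventual statement, so this also applies to a trajectory that
   keeps entering and leaving the ball. *)
have inside d : 0 < d -> \forall t \near +oo, `|x t| <= `|xs| -> `|x t - xs| <= d.
  move=> /stable[e e0 eP]; near=> t => xt; apply: eP; first by near: t; exact: vals.
  by rewrite (le_trans (_ : _ <= `|xs| ^+ 2)) ?lerDl ?(ltW e0)// ler_sqr ?nnegrE.
have weight : t `^ p * t ^+ 2 * eps t @[t --> +oo] --> +oo.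
  apply: weight_cvgy => // [pE|pgt].
    by apply: eps_alpha_eq3; move: pE; rewrite /p; lra.
  exists (p * (2 / 3 * alpha)); first by apply: mulr_gt0 => //; lra.
  by apply: eps_gt3; move: pgt; rewrite /p; lra.
have powE t : 0 < t -> t `^ (alpha / 3 + 1) = t `^ p * t ^+ 2.
  move=> tp; rewrite -powR_mulrn ?(ltW tp)// -powRD; last by rewrite (gt_eqF tp) implybT.
  by congr (_ `^ _); rewrite /p; lra.
pose I (t : R) := \int[lebesgue_measure]_(s in `[t0, t])
            (eps s ^+ 2 * s `^ (alpha / 3 + 1)).
have dI : \forall t \near +oo, is_derive t (1 : R) I (t `^ p * t ^+ 2 * eps t ^+ 2).
  apply: near_gt => t tt.
  rewrite -powE ?(lt_trans t0_gt0)// mulrC.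
  have powc s : 0 < s -> {for s, continuous (fun s : R => s `^ (alpha / 3 + 1))}.
    by move=> s0; exact: is_derive_continuous (is_derive1_powR (alpha / 3 + 1) s0).
  apply: (@is_derive_integral _ (fun s => eps s ^+ 2 * s `^ (alpha / 3 + 1))) => //.
    move=> s ts; have epsc := is_derive_continuous (deps _ ts).
    apply: cvgM; last by apply: powc; exact: lt_trans ts.
    by apply: cvgM; exact: epsc.
  (* At [t0] only the derivative relative to [A] is available, which still gives continuity from the
     right. *)
  have epsc : eps s @[s --> t0^'+] --> eps t0.
    have := derivable_within_cvg (eps_C1.1 t0 _); rewrite /= in_itv/= lexx => /(_ isT).
    apply: cvg_trans; apply: cvg_fmap2 => P hP.
    apply: (@filterS _ (nbhs t0) _ _ _ _ hP) => s h ts.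
    by apply: h; [rewrite gt_eqF|rewrite /= in_itv/= (ltW ts)].
  apply: cvgM; first by apply: cvgM; exact: epsc.
  by apply: cvg_at_right_filter; exact: powc.
have I_cvg : beta / (t `^ p * t ^+ 2 * eps t) * I t @[t --> +oo] --> (0 : R).
  apply: cvg_trans eps_int_lim; apply: near_eq_cvg; apply: near_gt => t tt.
  by rewrite powE ?(lt_trans t0_gt0)// [eps t * _]mulrC.
have outside : (\forall t \near +oo, `|xs| <= `|x t|) -> `|x t - xs| @[t --> +oo] --> (0 : R).
  move=> out; apply/cvgrPdist_le => d d0; have [e e0 eP] := stable _ d0.
  have e20 : 0 < e / 2 by lra.
  have key := regularized_gap_le Hdot g_min near_eps_ge0 alpha_ge3 beta_ge0
    (lt_trans ltr01 a1) near_decay diss weight dI I_cvg out e20.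
  near=> t; rewrite sub0r normrN normr_id.
  have et0 : 0 <= eps t by near: t; exact: near_eps_ge0.
  have et : 0 < eps t.
    rewrite lt_neqAle et0 andbT eq_sym; apply/eqP => e0t.
    have : 0 < t `^ p * t ^+ 2 * eps t by near: t; move/cvgryPgt : weight; exact.
    by rewrite e0t mulr0 ltxx.
  have kt : g (x t) - g xs + eps t * (`|x t| ^+ 2 - `|xs| ^+ 2) <= e / 2 * eps t.
    by near: t; exact: key.
  have gt := g_min (x t).
  apply: eP; first by near: t; exact: vals.
  have : eps t * (`|x t| ^+ 2 - `|xs| ^+ 2) <= eps t * (e / 2) by lra.
  by rewrite ler_pM2l//; lra.
split.
  apply: limf_einf_pinfty_eq0 => // d d0 V Vy.
  (* Either the trajectory is eventually outside the open ball and converges, or it is inside at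
     arbitrarily late times, where [inside] gives points close to [xs]. *)
  have [out|nout] := pselect (\forall t \near +oo, `|xs| <= `|x t|).
    have /cvgrPdist_le/(_ _ d0) h := outside out.
    have [t [Vt]] := filter_ex (filterI Vy h).
    by rewrite sub0r normrN normr_id; exists t.
  apply: contrapT => nex; apply: nout; near=> t.
  rewrite leNgt; apply/negP => /ltW xt; apply: nex; exists t.
    by near: t; exact: Vy.
  by move: xt; near: t; exact: inside.
move=> [T [t0T [inb|outb]]].
  apply/cvgrPdist_le => d d0; near=> t; rewrite sub0r normrN normr_id.
  have : `|x t| <= `|xs|.
    have : ball 0 `|xs| (x t).
      apply: inb; exists t => //=; rewrite in_itv/= andbT; near: t.
      exact: (nbhs_pinfty_ge (num_real _)).
    by rewrite -ball_normE /ball_/= sub0r normrN => /ltW.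
  by near: t; exact: inside.
apply: outside; near=> t.
have : ~ ball 0 `|xs| (x t).
  apply: outb; exists t => //=; rewrite in_itv/= andbT; near: t.
  exact: (nbhs_pinfty_ge (num_real _)).
by rewrite -ball_normE /ball_/= sub0r normrN => /negP; rewrite -leNgt.
Unshelve. all: by end_near. Qed.
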